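(* Let $\mathcal{X}_0$ be a set and $E_0,E_1$ Banach spaces. Let $\mathcal{B}_0(\mathcal{X}_0,E_0)$ and $\mathcal{B}_1(E_0,E_1)$ be two (nested) GRKBSs with configurations $(\mathcal{F}_0,\phi_0)$ and $(\mathcal{F}_1,\phi_1)$ respectively. For every $\mu\in\mathcal{F}_0$ the following Banach spaces are isometrically isomorphic: $$\frac{\mathcal{B}_1(E_0,E_1)}{\phi^{(1)}_*\bigl(\mathcal{N}_{\phi_1|_{\mathcal{X}_\mu}}/\mathcal{N}_{\phi_1}\bigr)}\;\cong\;\mathcal{B}_1(\mathcal{X}_\mu\subset E_0,E_1)\;\cong\;\mathcal{B}_\mu(\mathcal{X}_0,E_1),$$ where $\mathcal{X}_\mu=\{\phi_0(x)(\mu):x\in\mathcal{X}_0\}\subset E_0$ and $\phi^{(1)}_*:\mathcal{F}_1/\mathcal{N}_{\phi_1}\to\mathcal{B}_1(E_0,E_1)$ is the characteristic isometry of $\mathcal{B}_1(E_0,E_1)$.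
   Context: $L_{\mathrm{op}}(\mathcal{F},E)$ denotes the bounded linear operators from $\mathcal{F}$ to $E$; $\cong$ means isometrically isomorphic. For a set $\mathcal{X}$ and Banach space $E$, a GRKBS $\mathcal{B}(\mathcal{X},E)$ is a Banach space of functions $f:\mathcal{X}\to E$ (pointwise operations) for which every evaluation $f\mapsto f(x)$ is bounded. A configuration is a pair $(\mathcal{F},\phi)$, $\mathcal{F}$ a Banach space and $\phi:\mathcal{X}\to L_{\mathrm{op}}(\mathcal{F},E)$ any map, such that $\mathcal{B}(\mathcal{X},E)=\{f_\mu:\mu\in\mathcal{F}\}$, $f_\mu(x)=\phi(x)(\mu)$, with norm $\|f\|=\inf\{\|\mu\|_{\mathcal{F}}:f=f_\mu\}$; any such pair determines a GRKBS this way. Put $\mathcal{N}_\phi=\bigcap_{x\in\mathcal{X}}\ker\phi(x)$. The characteristic isometry is the isometric isomorphism $\phi_*:\mathcal{F}/\mathcal{N}_\phi\to\mathcal{B}(\mathcal{X},E)$, $\phi_*(\mu+\mathcal{N}_\phi)=f_\mu$. Quotients carry quotient norms. Restriction: for $\overline{\mathcal{X}}\subset\mathcal{X}$, $\mathcal{B}(\overline{\mathcal{X}}\subset\mathcal{X},E)$ is the GRKBS of functions $\overline{\mathcal{X}}\to E$ with configuration $(\mathcal{F},\phi|_{\overline{\mathcal{X}}})$. Thus $\mathcal{N}_{\phi_1|_{\mathcal{X}_\mu}}=\bigcap_{e\in\mathcal{X}_\mu}\ker\phi_1(e)\supset\mathcal{N}_{\phi_1}$, and $\mathcal{N}_{\phi_1|_{\mathcal{X}_\mu}}/\mathcal{N}_{\phi_1}$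 is regarded as a subspace of $\mathcal{F}_1/\mathcal{N}_{\phi_1}$. Composition: for $\mu\in\mathcal{F}_0$, $\mathcal{B}_\mu(\mathcal{X}_0,E_1)$ is the GRKBS of functions $\mathcal{X}_0\to E_1$ with configuration $(\mathcal{F}_1,\phi_\mu)$, where $\phi_\mu:\mathcal{X}_0\to L_{\mathrm{op}}(\mathcal{F}_1,E_1)$, $\phi_\mu(x)(\nu)=\phi_1(\phi_0(x)(\mu))(\nu)$. The family $\{\mathcal{B}_\mu(\mathcal{X}_0,E_1)\}_{\mu\in\mathcal{F}_0}$ is called a one-hidden-layer abstract neural network. *)

(* Defs.v *)
From HB Require Import structures.
From mathcomp Require Import all_boot all_order all_algebra.
From mathcomp Require Import ring_quotient.
From mathcomp Require Import all_classical all_reals all_analysis.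

Set Implicit Arguments.
Unset Strict Implicit.
Unset Printing Implicit Defensive.

Import Order.TTheory GRing.Theory Num.Theory.
Import numFieldNormedType.Exports.

Local Open Scope classical_set_scope.
Local Open Scope quotient_scope.
Local Open Scope ring_scope.

Definition isometrically_isomorphic (R : realType)
    (V W : completeNormedModType R) : Prop :=
  exists2 f : {linear V -> W}, bijective f & forall v, `|f v| = `|v|.

(* The norm pushed forward along a linear surjection; both the norm of a
   quotient and the norm of a space of functions f_mu are of this form. *)
Section InfNorm.
Context {R : realType} {V : normedModType R} {W : lmodType R}.
Variable f : {linear V -> W}.

Definition inf_norm (y : W) : R := inf [set `|v| | v in [set v | y = f v]].

Hypothesis f_surj : forall y, exists v, y = f v.
Hypothesis f_ker : closed [set v | f v = 0].

Lemma inf_norm_has_inf y : has_inf [set `|v| | v in [set v | y = f v]].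
Proof.
split; first by have [v ->] := f_surj y; exists `|v|, v.
by exists 0 => _ [v _ <-].
Qed.

Lemma inf_norm_le v : inf_norm (f v) <= `|v|.
Proof. by apply: ge_inf; [case: (inf_norm_has_inf (f v))|exists v]. Qed.

Lemma inf_norm_ge0 y : 0 <= inf_norm y.
Proof.
by apply: lb_le_inf; [case: (inf_norm_has_inf y)|move=> _ [v _ <-]].
Qed.

Lemma inf_norm_lt y e : 0 < e -> exists2 v, y = f v & `|v| < inf_norm y + e.
Proof.
by move=> /inf_adherent /(_ (inf_norm_has_inf y))[_ [v yv <-] ?]; exists v.
Qed.

Lemma inf_normD x y : inf_norm (x + y) <= inf_norm x + inf_norm y.
Proof.
apply/ler_addgt0Pr => e e0; have e20 : 0 < e / 2 by rewrite divr_gt0.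
have [u -> ux] := inf_norm_lt x e20; have [v -> vy] := inf_norm_lt y e20.
rewrite -linearD (le_trans (inf_norm_le _))// (le_trans (ler_normD _ _))//.
by rewrite [e]splitr addrACA lerD// ltW.
Qed.

Lemma inf_norm0 : inf_norm 0 = 0.
Proof.
apply/le_anti; rewrite inf_norm_ge0 andbT.
by rewrite -(linear0 f) -[leRHS](@normr0 _ V) inf_norm_le.
Qed.

Lemma inf_normZ_le (l : R) y : inf_norm (l *: y) <= `|l| * inf_norm y.
Proof.
have [->|l0] := eqVneq l 0; first by rewrite scale0r inf_norm0 normr0 mul0r.
have nl0 : 0 < `|l| by rewrite normr_gt0.
apply/ler_addgt0Pr => e e0; have el0 : 0 < e / `|l| by rewrite divr_gt0.
have [v -> vy] := inf_norm_lt y el0.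
rewrite -linearZ (le_trans (inf_norm_le _))// normrZ.
rewrite -[e in leRHS](divfK (lt0r_neq0 nl0)) [_ / _ * _]mulrC -mulrDr.
by rewrite ler_pM2l// ltW.
Qed.

Lemma inf_normZ (l : R) y : inf_norm (l *: y) = `|l| * inf_norm y.
Proof.
apply/le_anti; rewrite inf_normZ_le/=.
have [->|l0] := eqVneq l 0; first by rewrite normr0 mul0r inf_norm_ge0.
have nl0 : 0 < `|l| by rewrite normr_gt0.
rewrite -ler_pdivlMl// -normfV.
by rewrite -[y in leLHS]scale1r -(mulVf l0) -scalerA inf_normZ_le.
Qed.

Lemma inf_norm_eq0 y : inf_norm y = 0 -> y = 0.
Proof.
have [v ->] := f_surj y => fv0; apply: f_ker => B /nbhs_ballP[e/= e0 veB].
have [u fvu] := inf_norm_lt (f v) e0; rewrite fv0 add0r => ue.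
exists (v - u); split; first by rewrite /= linearB fvu subrr.
by apply: veB; rewrite -ball_normE/= opprB addrC subrK.
Qed.

End InfNorm.

Lemma quotient_map_complete (R : realType) (V : completeNormedModType R)
    (W : normedModType R) (f : {linear V -> W}) :
  (forall y, exists v, y = f v) -> (forall y, `|y| = inf_norm f y) ->
  forall G : set_system W, ProperFilter G -> cauchy G -> cvg G.
Proof.
move=> fs fn G GF /cauchy_ballP Gc.
pose r n : R := (2^-1) ^+ n.
have half1 : 2^-1 < 1 :> R by rewrite invf_lt1// ltr1n.
have r0 n : 0 < r n by rewrite exprn_gt0// invr_gt0.
have lift y e : `|y| < e -> exists2 v, y = f v & `|v| < e.
  move=> ye; have e0 : 0 < e - `|y| by rewrite subr_gt0.
  have [v yv] := inf_norm_lt fs y e0.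
  by rewrite -fn addrC subrK; exists v.
have /choice[y Gy] n : exists y, G (ball y (r n)).
  have /cauchyP/(_ _ (r0 n))[y Gy] : cauchy G by exact/cauchy_ballP.
  by exists y.
have yS n : `|y n.+1 - y n| < r n + r n.+1.
  have [z []] := filter_ex (filterI (Gy n) (Gy n.+1)).
  rewrite -!ball_normE/= => yz zy.
  rewrite -(subrKA z) addrC (le_lt_trans (ler_normD _ _))//.
  by rewrite distrC [`|_ - z|]distrC ltrD// distrC// [`|z - _|]distrC.
have /choice[w wP] n : exists w, y n.+1 - y n = f w /\ `|w| < r n + r n.+1.
  by have [w ? ?] := lift _ _ (yS n); exists w.
have [v0 y0] := fs (y 0).
have yE n : y n = f (v0 + series w n).
  elim: n => [|n IH]; first by rewrite /series/= big_geq// addr0.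
  by rewrite seriesSr addrA linearD -IH -(wP n).1 addrC subrK.
have /normed_cvg cw : cvgn [normed series w].
  apply: (@series_le_cvg _ _ (geometric 2 2^-1)) => //=.
  - move=> n; apply: (le_trans (ltW (wP n).2)).
    rewrite /r mulr_natl mulr2n lerD2l exprS ler_piMl ?exprn_ge0 ?invr_ge0//.
    exact: ltW.
  - apply: is_cvg_geometric_series.
    by rewrite ger0_norm ?invr_ge0.
set s := limn (series w) in cw.
apply/cvg_ex; exists (f (v0 + s)).
apply/cvgrPdist_lt => e e0.
have e20 : 0 < e / 2 by rewrite divr_gt0.
have rcv : r @ \oo --> (0 : R).
  by apply: cvg_expr; rewrite ger0_norm ?invr_ge0.
have : \forall n \near \oo, `|s - series w n| < e / 2 /\ r n < e / 2.
  near=> n; split; near: n; first by move/cvgrPdist_lt : cw; apply.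
  move/cvgrPdist_lt : rcv => /(_ _ e20); apply: filterS => n.
  by rewrite sub0r normrN gtr0_norm.
move=> /filter_ex[n [sn rn]].
apply: filterS (Gy n) => z; rewrite -ball_normE/= => yz.
rewrite -(subrKA (y n)) (le_lt_trans (ler_normD _ _))// [e]splitr ltrD//.
  rewrite yE -linearB opprD addrACA subrr add0r fn.
  exact: le_lt_trans (inf_norm_le fs _) sn.
exact: lt_trans yz rn.
Unshelve. all: by end_near. Qed.

Record closed_subspace (R : realType) (V : normedModType R) :=
  ClosedSubspace {
    cs_set :> set V;
    cs0 : cs_set 0;
    csD : forall u v, cs_set u -> cs_set v -> cs_set (u + v);
    csZ : forall (a : R) v, cs_set v -> cs_set (a *: v);
    cs_closed : closed cs_set }.

Definition cs_pred (R : realType) (V : normedModType R)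
  (N : closed_subspace V) : {pred V} := fun v => v \in (N : set V).

Section Quotient.
Context {R : realType} {V : normedModType R}.
Variable N : closed_subspace V.

Lemma cs_zmod : zmod_closed (cs_pred N).
Proof.
split; first exact/mem_set/cs0.
move=> u v /set_mem Nu /set_mem Nv; apply/mem_set/csD => //.
by rewrite -scaleN1r; exact: csZ.
Qed.

HB.instance Definition _ := GRing.isZmodClosed.Build V (cs_pred N) cs_zmod.

(* The space V / N; \pi_(quotient N) v is the coset v + N. *)
Definition quotient := Quotient.quot (cs_pred N).

HB.instance Definition _ := GRing.Zmodule.on quotient.
HB.instance Definition _ := EqQuotient.on quotient.

Definition coset (v : V) : quotient := \pi v.

Lemma cosetP u v : coset u = coset v <-> cs_set N (u - v).
Proof.
rewrite /coset; split=> [/eqP|Nuv].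
  by rewrite -Quotient.idealrBE => /set_mem.
by apply/eqP; rewrite -Quotient.idealrBE; exact/mem_set.
Qed.

Lemma coset_surj (y : quotient) : exists v, y = coset v.
Proof. by exists (repr y); rewrite /coset reprK. Qed.

Lemma cosetD : {morph coset : u v / u + v}.
Proof. by move=> u v; rewrite /coset [LHS]raddfD. Qed.

Definition quotient_scale (a : R) (y : quotient) : quotient :=
  coset (a *: repr y).

Lemma coset_scale a v : quotient_scale a (coset v) = coset (a *: v).
Proof.
apply/cosetP; rewrite -scalerBr; apply: csZ.
by apply/cosetP; rewrite /coset reprK.
Qed.

Lemma quotient_scaleA a b y :
  quotient_scale a (quotient_scale b y) = quotient_scale (a * b) y.
Proof. by have [v ->] := coset_surj y; rewrite !coset_scale scalerA. Qed.

Lemma quotient_scale1 : left_id 1 quotient_scale.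
Proof.
by move=> y; have [v ->] := coset_surj y; rewrite coset_scale scale1r.
Qed.

Lemma quotient_scaleDr : right_distributive quotient_scale +%R.
Proof.
move=> a x y; have [u ->] := coset_surj x; have [v ->] := coset_surj y.
by rewrite -cosetD !coset_scale scalerDr cosetD.
Qed.

Lemma quotient_scaleDl y : {morph quotient_scale^~ y : a b / a + b}.
Proof.
move=> a b; have [v ->] := coset_surj y.
by rewrite !coset_scale scalerDl cosetD.
Qed.

HB.instance Definition _ := GRing.Zmodule_isLmodule.Build R quotient
  quotient_scaleA quotient_scale1 quotient_scaleDr quotient_scaleDl.

Lemma coset_linear : linear coset.
Proof. by move=> a u v; rewrite cosetD -coset_scale. Qed.

HB.instance Definition _ :=
  GRing.isLinear.Build R V quotient *:%R coset coset_linear.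

Lemma coset_eq0 v : coset v = 0 <-> cs_set N v.
Proof. by rewrite -(linear0 coset) cosetP subr0. Qed.

Lemma coset_ker : closed [set v | coset v = 0].
Proof.
suff -> : [set v | coset v = 0] = cs_set N by exact: cs_closed.
by apply/seteqP; split=> v /coset_eq0.
Qed.

HB.instance Definition _ := Lmodule_isNormed.Build R quotient
  (inf_normD coset_surj) (inf_normZ coset_surj)
  (inf_norm_eq0 coset_surj coset_ker).

Lemma quotient_normE (y : quotient) :
  `|y| = inf [set `|v| | v in [set v | y = coset v]].
Proof. by []. Qed.

End Quotient.

HB.instance Definition _ (R : realType) (V : completeNormedModType R)
    (N : closed_subspace V) := Uniform_isComplete.Build (quotient N)
  (quotient_map_complete (@coset_surj R V N) (fun=> erefl)).

(* Boundedness is for the operator norm: this is L_op(F, E). *)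
Record bounded_operator (R : realType) (F E : normedModType R) :=
  BoundedOperator {
    bop_fun :> {linear F -> E};
    bop_bounded : exists M : R, forall mu, `|bop_fun mu| <= M * `|mu| }.

Section Feature.
Context {R : realType} {X : Type} {F E : normedModType R}.
Variable phi : X -> bounded_operator F E.

(* mu |-> f_mu *)
Definition feature (mu : F) : X -> E := fun x => phi x mu.

Lemma feature_linear : linear feature.
Proof. by move=> a u v; apply/funext => x; rewrite /feature linearP. Qed.

HB.instance Definition _ :=
  GRing.isLinear.Build R F (X -> E) *:%R feature feature_linear.

Lemma bop_ker_closed x : closed [set mu | phi x mu = 0].
Proof.
have /linear_bounded_continuous c : bounded_near (phi x) (nbhs 0).
  apply/linear_boundedP; have [M MP] := bop_bounded (phi x).
  near=> r => mu; apply: (le_trans (MP mu)).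
  by rewrite ler_wpM2r//; near: r; exact: nbhs_pinfty_ge (num_real M).
rewrite (_ : mkset _ = phi x @^-1` [set 0])//.
apply: closed_comp => [? _|]; first exact: c.
exact/accessible_closed_set1/hausdorff_accessible/norm_hausdorff.
Unshelve. all: by end_near. Qed.

Lemma null_set_closed : closed [set mu | forall x, phi x mu = 0].
Proof.
rewrite (_ : mkset _ = \bigcap_(x in setT) [set mu | phi x mu = 0]).
  by apply: closed_bigI => x _; exact: bop_ker_closed.
by apply/seteqP; split=> [mu h x _|mu h x]; [exact: h|exact: (h x I)].
Qed.

Lemma null_set0 (x : X) : phi x 0 = 0. Proof. exact: linear0. Qed.

Lemma null_setD u v : (forall x, phi x u = 0) -> (forall x, phi x v = 0) ->
  forall x, phi x (u + v) = 0.
Proof. by move=> hu hv x; rewrite linearD hu hv addr0. Qed.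

Lemma null_setZ a v : (forall x, phi x v = 0) -> forall x, phi x (a *: v) = 0.
Proof. by move=> hv x; rewrite linearZ/= hv scaler0. Qed.

(* N_phi *)
Definition null_space : closed_subspace F :=
  @ClosedSubspace R F [set mu | forall x, phi x mu = 0]
    null_set0 null_setD null_setZ null_set_closed.

Lemma feature_eq0 mu : feature mu = 0 <-> cs_set null_space mu.
Proof.
by split=> [h x|h]; [rewrite -[LHS]/(feature mu x) h|exact/funext].
Qed.

End Feature.

(* A Banach space of functions is given by its Banach space of elements and the
   injective linear map sending an element to the function that it is. *)
Record grkbs (R : realType) (X : Type) (E : completeNormedModType R) :=
  GRKBS {
    gk_space :> completeNormedModType R;
    gk_fun : {linear gk_space -> (X -> E)};
    gk_inj : injective gk_fun;
    gk_eval : forall x, exists M : R, forall f, `|gk_fun f x| <= M * `|f| }.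

Arguments gk_fun {R X E g}.

Definition is_configuration (R : realType) (X : Type)
    (E : completeNormedModType R) (B : grkbs X E)
    (F : completeNormedModType R) (phi : X -> bounded_operator F E) : Prop :=
  range (@gk_fun _ _ _ B) = range (feature phi) /\
  forall f : B,
    `|f| = inf [set `|mu| | mu in [set mu | gk_fun f = feature phi mu]].

Section GrkbsOf.
Context {R : realType} {X : Type} {E F : completeNormedModType R}.
Variable phi : X -> bounded_operator F E.

Definition feature_pred : {pred (X -> E)} := fun f => f \in range (feature phi).

Lemma feature_submod : submod_closed feature_pred.
Proof.
split; first by apply/mem_set; exists 0 => //; exact: linear0.
move=> a f g /set_mem[u _ <-] /set_mem[v _ <-].
by apply/mem_set; exists (a *: u + v) => //; rewrite linearP.
Qed.

HB.instance Definition _ := GRing.isSubmodClosed.Build R (X -> E) feature_pred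
  feature_submod.

Record feature_space := FeatureSpace {
  fs_fun :> X -> E;
  fs_funP : fs_fun \in feature_pred }.

HB.instance Definition _ := [isSub for fs_fun].
HB.instance Definition _ := [Choice of feature_space by <:].
HB.instance Definition _ :=
  [SubChoice_isSubLmodule of feature_space by <:].

Lemma fs_fun_linear : linear fs_fun.
Proof. by []. Qed.

HB.instance Definition _ :=
  GRing.isLinear.Build R feature_space (X -> E) *:%R fs_fun fs_fun_linear.

Definition feature_map (mu : F) : feature_space :=
  FeatureSpace (mem_set (imageT (feature phi) mu)).

Lemma feature_map_linear : linear feature_map.
Proof. by move=> a u v; apply: val_inj; rewrite /= linearP. Qed.

HB.instance Definition _ :=
  GRing.isLinear.Build R F feature_space *:%R feature_map feature_map_linear.

Lemma feature_map_surj f : exists mu, f = feature_map mu.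
Proof.
by have [mu _ fE] := set_mem (fs_funP f); exists mu; exact: val_inj.
Qed.

Lemma feature_map_eq0 mu : feature_map mu = 0 <-> cs_set (null_space phi) mu.
Proof.
rewrite -feature_eq0; split=> [/(congr1 val)//|h]; exact: val_inj.
Qed.

Lemma feature_map_ker : closed [set mu | feature_map mu = 0].
Proof.
rewrite (_ : mkset _ = cs_set (null_space phi)); first exact: cs_closed.
by apply/seteqP; split=> mu /feature_map_eq0.
Qed.

HB.instance Definition _ := Lmodule_isNormed.Build R feature_space
  (inf_normD feature_map_surj) (inf_normZ feature_map_surj)
  (inf_norm_eq0 feature_map_surj feature_map_ker).

HB.instance Definition _ := Uniform_isComplete.Build feature_space
  (quotient_map_complete feature_map_surj (fun=> erefl)).

Lemma fs_fun_inj : injective fs_fun. Proof. exact: val_inj. Qed.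

Lemma fs_eval x : exists M : R,
  forall f : feature_space, `|fs_fun f x| <= M * `|f|.
Proof.
have [M MP] := bop_bounded (phi x); exists (Num.max M 1) => f.
have M0 : 0 < Num.max M 1 by rewrite lt_max ltr01 orbT.
rewrite -ler_pdivrMl//; apply: lb_le_inf.
  by case: (inf_norm_has_inf feature_map_surj f).
move=> _ [mu -> <-]; rewrite ler_pdivrMl// (le_trans (MP mu))//.
by rewrite ler_wpM2r// le_max lexx.
Qed.

(* The space of functions f_mu determined by (F, phi). *)
Definition grkbs_of : grkbs X E :=
  @GRKBS R X E feature_space fs_fun fs_fun_inj fs_eval.

Lemma grkbs_of_configuration : is_configuration grkbs_of phi.
Proof.
split=> [|f].
  apply/seteqP; split=> g [].
    by move=> f _ <-; exact/set_mem/fs_funP.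
  by move=> mu _ <-; exists (feature_map mu).
rewrite -[LHS]/(inf_norm feature_map f); congr (inf (image _ _)).
apply/seteqP; split=> mu /=; first by move=> ->.
by move=> fE; exact: val_inj.
Qed.

End GrkbsOf.

Lemma coset_feature (R : realType) (X : Type) (F E : normedModType R)
    (phi : X -> bounded_operator F E) mu nu :
  coset (null_space phi) mu = coset (null_space phi) nu <->
  feature phi mu = feature phi nu.
Proof.
rewrite cosetP -feature_eq0 linearB.
split=> [/subr0_eq//|h]; apply/eqP; rewrite subr_eq0; exact/eqP.
Qed.

Section CharacteristicIsometry.
Context {R : realType} {X : Type} {E F : completeNormedModType R}.
Variables (B : grkbs X E) (phi : X -> bounded_operator F E).
Hypothesis conf : is_configuration B phi.

Lemma char_isometry_ex (y : quotient (null_space phi)) :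
  exists f : B, gk_fun f = feature phi (repr y).
Proof.
have : range (@gk_fun _ _ _ B) (feature phi (repr y)).
  by rewrite conf.1; exists (repr y).
by move=> [f _ fE]; exists f.
Qed.

Definition char_isometry (y : quotient (null_space phi)) : B :=
  sval (cid (char_isometry_ex y)).

(* phi_* (mu + N_phi) = f_mu *)
Lemma char_isometryE mu :
  gk_fun (char_isometry (coset (null_space phi) mu)) = feature phi mu.
Proof.
rewrite /char_isometry; case: cid => f /= ->.
by apply/coset_feature; rewrite /coset reprK.
Qed.

Lemma char_isometry_linear : linear char_isometry.
Proof.
move=> a x y; have [u ->] := coset_surj x; have [v ->] := coset_surj y.
have -> : a *: coset _ u + coset _ v = coset (null_space phi) (a *: u + v).
  by rewrite linearP.
by apply: gk_inj; rewrite [RHS]linearP !char_isometryE linearP.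
Qed.

HB.instance Definition _ :=
  GRing.isLinear.Build R (quotient (null_space phi)) B *:%R char_isometry
    char_isometry_linear.

Lemma char_isometry_surj f : exists y, f = char_isometry y.
Proof.
have : range (feature phi) (gk_fun f) by rewrite -conf.1; exists f.
move=> [mu _ fE]; exists (coset _ mu).
by apply: gk_inj; rewrite char_isometryE.
Qed.

Lemma char_isometry_norm y : `|char_isometry y| = `|y|.
Proof.
have [mu ->] := coset_surj y.
rewrite conf.2 quotient_normE char_isometryE; congr (inf (image _ _)).
by apply/seteqP; split=> nu /coset_feature.
Qed.

Lemma char_isometry_bij : bijective char_isometry.
Proof.
have inj : injective char_isometry.
  move=> x y h; apply/eqP; rewrite -subr_eq0 -normr_eq0 -char_isometry_norm.
  by rewrite linearB/= h subrr normr0.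
have [g gK] := choice char_isometry_surj.
by exists g => [x|f]; [apply: inj|]; rewrite -gK.
Qed.

End CharacteristicIsometry.

Section Subspaces.
Context {R : realType}.

Lemma isometry_image_closed (V W : normedModType R) (f : {linear V -> W}) :
  (forall y, exists v, y = f v) -> (forall v, `|f v| = `|v|) ->
  forall N : closed_subspace V, closed (f @` N).
Proof.
move=> fs fn N y /= ycl; have [v yv] := fs y; exists v => //.
apply: (@cs_closed _ _ N) => U /nbhs_ballP[e/= e0 veU].
have [_ [[u Nu <-]]] := ycl _ (nbhsx_ballx y e e0).
rewrite -ball_normE/= yv -linearB fn => vu.
by exists u; split=> //; apply: veU; rewrite -ball_normE.
Qed.

Lemma coset_image_closed (V : normedModType R) (N M : closed_subspace V) :
  cs_set N `<=` cs_set M -> closed (coset N @` M).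
Proof.
move=> NM y /= ycl; have [v yv] := coset_surj y; exists v => //.
apply: (@cs_closed _ _ M) => U /nbhs_ballP[e/= e0 veU].
have [_ [[u Mu <-]]] := ycl _ (nbhsx_ballx y e e0).
rewrite -ball_normE/= yv -linearB => vu.
have e1 : 0 < e - `|coset N (v - u)| by rewrite subr_gt0.
have [w vuw] := inf_norm_lt (@coset_surj _ _ N) (coset N (v - u)) e1.
rewrite -[inf_norm _ _]/(`|coset N (v - u)|) addrC subrK => we.
exists (v - w); split; last first.
  by apply: veU; rewrite -ball_normE/= opprB addrC subrK.
have /NM Mvuw : cs_set N (v - u - w) by apply/cosetP.
have -> : v - w = u + (v - u - w) by rewrite addrA [u + _]addrC subrK.
exact: csD.
Qed.

Section ImageSubspace.
Variables (V W : normedModType R) (f : {linear V -> W}) (N : closed_subspace V).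

Lemma image_subspace0 : (f @` N) 0.
Proof. by exists 0; [exact: cs0|exact: linear0]. Qed.

Lemma image_subspaceD u v : (f @` N) u -> (f @` N) v -> (f @` N) (u + v).
Proof.
move=> [x Nx <-] [y Ny <-]; exists (x + y); last exact: linearD.
exact: csD.
Qed.

Lemma image_subspaceZ (a : R) v : (f @` N) v -> (f @` N) (a *: v).
Proof.
by move=> [x Nx <-]; exists (a *: x); [exact: csZ|exact: linearZ].
Qed.

Definition image_subspace (fN : closed (f @` N)) : closed_subspace W :=
  ClosedSubspace image_subspace0 image_subspaceD image_subspaceZ fN.

End ImageSubspace.

(* M / N, regarded as a subspace of V / N *)
Definition subspace_quotient (V : normedModType R) (N M : closed_subspace V)
    (NM : cs_set N `<=` cs_set M) : closed_subspace (quotient N) :=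
  image_subspace (coset_image_closed NM).

End Subspaces.

Section RestrictionComposition.
Context {R : realType}.

Definition restriction (X : Type) (F E : normedModType R)
    (phi : X -> bounded_operator F E) (A : set X) : A -> bounded_operator F E :=
  fun x => phi (set_val x).
Arguments restriction {X F E} phi A.

Lemma null_space_restriction (X : Type) (F E : normedModType R)
    (phi : X -> bounded_operator F E) (A : set X) :
  cs_set (null_space phi) `<=` cs_set (null_space (restriction phi A)).
Proof. by move=> mu h x /=; exact: h. Qed.
Arguments null_space_restriction {X F E} phi A.

(* phi_mu *)
Definition composition (X : Type) (E0 E1 F0 F1 : normedModType R)
    (phi0 : X -> bounded_operator F0 E0) (phi1 : E0 -> bounded_operator F1 E1)
    (mu : F0) : X -> bounded_operator F1 E1 := fun x => phi1 (phi0 x mu).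

(* phi_* (N) for a closed subspace N of F / N_phi *)
Definition char_isometry_image (X : Type) (E F : completeNormedModType R)
    (B : grkbs X E) (phi : X -> bounded_operator F E)
    (conf : is_configuration B phi)
    (N : closed_subspace (quotient (null_space phi))) : closed_subspace B :=
  image_subspace (f := char_isometry conf) (isometry_image_closed
    (N := N) (char_isometry_surj conf) (char_isometry_norm conf)).

End RestrictionComposition.

Arguments restriction {R X F E} phi A.
Arguments null_space_restriction {R X F E} phi A.

(* Main.v *)
(** Each of the three spaces is the image of F1 under a linear surjection whose
    norm is the infimum of the norms of the preimages, and the three surjections
    have the same kernel: the null space of phi1 restricted to Xmu.  Linear
    surjections with infimum norms and equal kernels have isometrically
    isomorphic targets. *)
From HB Require Import structures.
Require Import Defs.
From mathcomp Require Import all_boot all_order all_algebra.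
From mathcomp Require Import all_classical all_reals all_analysis.
Local Open Scope classical_set_scope.
Local Open Scope ring_scope.

Import Order.TTheory GRing.Theory Num.Theory.
Import numFieldNormedType.Exports.

(** The norm of [W] is itself an infimum over [f]-preimages, so the infimum over preimages in [V]
    can be taken in two stages. *)
Lemma inf_norm_comp (R : realType) (V W : normedModType R) (Z : lmodType R)
    (f : {linear V -> W}) (g : {linear W -> Z}) :
  (forall y, exists v, y = f v) -> (forall z, exists y, z = g y) ->
  (forall y, `|y| = inf_norm f y) ->
  forall z, inf_norm g z = inf_norm (g \o f) z.
Proof.
move=> fs gs fn z.
have gfs z' : exists v, z' = (g \o f) v.
  by have [y ->] := gs z'; have [v ->] := fs y; exists v.
apply/le_anti/andP; split; apply/ler_addgt0Pr => e e0.
  have [v zv ve] := inf_norm_lt gfs z e0; rewrite zv/= in ve *.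
  apply: le_trans (inf_norm_le gs _) _; rewrite fn.
  exact: le_trans (inf_norm_le fs _) (ltW ve).
have [y -> ye] := inf_norm_lt gs z e0.
(* The slack that [y] leaves is exactly what the choice of its preimage [v] may cost. *)
have d0 : 0 < inf_norm g (g y) + e - `|y| by rewrite subr_gt0.
have [v yv] := inf_norm_lt fs y d0.
rewrite -fn addrC subrK => /ltW; apply: le_trans.
by rewrite {1}yv; exact: (inf_norm_le gfs v).
Qed.

(** Equal kernels give [p] and [q] the same fibres, so sending [p v] to [q v] is well defined and
    injective, and both norms are infima over one set. *)
Lemma inf_norm_same_kernel (R : realType) (F : normedModType R)
    (V W : completeNormedModType R)
    (p : {linear F -> V}) (q : {linear F -> W}) :
  (forall y, exists v, y = p v) -> (forall y, exists v, y = q v) ->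
  (forall y, `|y| = inf_norm p y) -> (forall y, `|y| = inf_norm q y) ->
  (forall v, p v = 0 <-> q v = 0) ->
  isometrically_isomorphic V W.
Proof.
move=> ps qs pn qn pq.
have pqE u v : p u = p v <-> q u = q v.
  split=> h; apply/eqP; rewrite -subr_eq0 -linearB; apply/eqP/pq;
    by rewrite linearB h subrr.
have [s sK] := choice ps; have [t tK] := choice qs.
(* The section [s] is arbitrary and need not be linear; [hE] shows that [h] does not depend on it,
   whence linearity. *)
pose h y := q (s y).
have hE v : h (p v) = q v by apply/pqE; rewrite -sK.
have hlin : linear h.
  move=> a x y; have [u ->] := ps x; have [v ->] := ps y.
  by rewrite -linearP !hE linearP.
pose hL := GRing.isLinear.Build R V W *:%R h hlin.
pose H : {linear V -> W} := HB.pack h hL.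
exists H.
  exists (p \o t) => y /=.
    by rewrite [RHS]sK; apply/pqE; rewrite -tK.
  by rewrite [RHS]tK; exact: hE.
move=> y; have [v ->] := ps y; rewrite [H _]hE pn qn; congr (inf (image _ _)).
by apply/seteqP; split=> u /= /pqE.
Qed.

Lemma configuration_norm (R : realType) (X : Type)
    (E F : completeNormedModType R) (B : grkbs X E)
    (phi : X -> bounded_operator F E) (conf : is_configuration B phi) (f : B) :
  `|f| = inf_norm (char_isometry conf \o coset (null_space phi)) f.
Proof.
rewrite conf.2; congr (inf (image _ _)); apply/seteqP; split=> mu /= fE.
  by apply: gk_inj; rewrite char_isometryE.
by rewrite fE char_isometryE.
Qed.

(** The characteristic isometry is injective, and since [M] contains the null space, membership in
    [M] depends only on the coset. *)
Lemma char_isometry_image_coset (R : realType) (X : Type)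
    (E F : completeNormedModType R) (B : grkbs X E)
    (phi : X -> bounded_operator F E) (conf : is_configuration B phi)
    (M : closed_subspace F) (NM : cs_set (null_space phi) `<=` cs_set M) mu :
  cs_set (char_isometry_image conf (subspace_quotient NM))
    (char_isometry conf (coset (null_space phi) mu)) <-> cs_set M mu.
Proof.
split=> [[_ [nu Mnu <-]]|Mmu]; last first.
  by exists (coset (null_space phi) mu) => //; exists mu.
move=> /(bij_inj (char_isometry_bij conf))/esym/cosetP/NM Mmunu.
by rewrite -(subrK nu mu); exact: csD.
Qed.

Theorem theorem18 (R : realType) (X0 : Type)
    (E0 E1 F0 F1 : completeNormedModType R)
    (B0 : grkbs X0 E0) (B1 : grkbs E0 E1)
    (phi0 : X0 -> bounded_operator F0 E0)
    (phi1 : E0 -> bounded_operator F1 E1)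
    (conf0 : is_configuration B0 phi0) (conf1 : is_configuration B1 phi1)
    (mu : F0) :
  let Xmu : set E0 := [set phi0 x mu | x in [set: X0]] in
  isometrically_isomorphic
    (quotient (char_isometry_image conf1
       (subspace_quotient (null_space_restriction phi1 Xmu))))
    (grkbs_of (restriction phi1 Xmu)) /\
  isometrically_isomorphic
    (grkbs_of (restriction phi1 Xmu))
    (grkbs_of (composition phi0 phi1 mu)).
Proof.
move=> Xmu; split.
  set M := char_isometry_image _ _.
  (* [c] sends [nu] to the element of [B1] that is the function f_nu; following it by [coset M]
     makes the quotient an image of [F1]. *)
  pose c := char_isometry conf1 \o coset (null_space phi1).
  have cs f : exists nu, f = c nu.
    have [y ->] := char_isometry_surj conf1 f.
    by have [nu ->] := coset_surj y; exists nu.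
  apply: (@inf_norm_same_kernel _ _ _ _ (coset M \o c)
    (feature_map (restriction phi1 Xmu))) => //.
  - move=> y; have [f ->] := coset_surj y.
    by have [nu ->] := cs f; exists nu.
  - exact: feature_map_surj.
  (* The quotient norm is by definition the infimum norm of [coset M], and the norm of [B1] is that
     of [c]. *)
  - move=> y; rewrite -inf_norm_comp//; first exact: coset_surj.
    exact: configuration_norm.
  - move=> nu; rewrite feature_map_eq0 /= coset_eq0.
    exact: char_isometry_image_coset.
apply: (@inf_norm_same_kernel _ _ _ _ (feature_map (restriction phi1 Xmu))
  (feature_map (composition phi0 phi1 mu))) => //.
- exact: feature_map_surj.
- exact: feature_map_surj.
(* Both kernels ask that [phi1 e nu] vanish for the same [e], since the points of [Xmu] are exactly
   the values [phi0 x mu]. *)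
- move=> nu; rewrite !feature_map_eq0; split=> /= h x.
    have Xx : Xmu (phi0 x mu) by exists x.
    exact: (h (SigSub (mem_set Xx))).
  by have [x' _ xE] := set_valP x; move: (h x'); rewrite /composition xE.
Qed.
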